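(* Let $X\neq L^\infty$ be any rearrangement invariant (r.i.) space on $[0,1]$. Then the operator $\mathcal{C}\colon[\mathcal{C},X]\to X$ is not compact.
   Context: $\lambda$ is Lebesgue measure on $[0,1]$; $f^*$ is the decreasing rearrangement of a measurable function $f$ on $[0,1]$ (right-continuous inverse of $\tau\mapsto\lambda(\{|f|>\tau\})$). A Banach function space (B.f.s.) $X$ on $[0,1]$ is a Banach space of ($\lambda$-a.e. classes of) measurable functions on $[0,1]$ such that $g\in X$ and $\|g\|_X\le\|f\|_X$ whenever $f\in X$ and $|g|\le|f|$ a.e. A r.i. space is a B.f.s. on $[0,1]$ such that if $g^*\le f^*$ and $f\in X$ then $g\in X$ and $\|g\|_X\le\|f\|_X$. Every r.i. space satisfies $L^\infty\subseteq X\subseteq L^1$. The Fatou property is not assumed. The Cesàro operator is $\mathcal{C}(f)(x):=\frac1x\int_0^x f(t)\,dt$. The Cesàro space is the B.f.s. $[\mathcal{C},X]:=\{f:\mathcal{C}(|f|)\in X\}$ with norm $\|f\|_{[\mathcal{C},X]}:=\|\mathcal{C}(|f|)\|_X$. *)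

(* Defs.v *)
From HB Require Import structures.
From mathcomp Require Import all_boot all_order all_algebra.
From mathcomp Require Import all_classical all_reals all_analysis.
From mathcomp Require Import measurable_realfun.

Set Implicit Arguments.
Unset Strict Implicit.
Unset Printing Implicit Defensive.

Import Order.TTheory GRing.Theory Num.Theory.
Import numFieldNormedType.Exports.

Local Open Scope classical_set_scope.
Local Open Scope ring_scope.

(* Lebesgue measure on [0, 1], as a measure on the line carried by [0, 1]: the
   values of a function outside [0, 1] are irrelevant up to a.e. equality. *)
Definition lebesgue01 (R : realType) :
    {measure set (measurableTypeR R) -> \bar R} :=
  mrestr (@lebesgue_measure R) (measurable_itv `[(0 : R), 1]).

(* a.e. classes of measurable functions on [0, 1]; a class coerces to a function
   (one of its representatives). *)
Notation mclass R :=
  {mfun_ (lebesgue01 R), measurableTypeR R >-> measurableTypeR R}.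

(* A linear space of classes is presented as a Banach space together with an
   injective map to classes that is linear. *)
Record bfs (R : realType) := Bfs {
  bfs_space :> completeNormedModType R;
  bfs_class : bfs_space -> mclass R;
  bfs_class_inj : injective bfs_class;
  bfs_class_linear : forall (a : R) (u v : bfs_space),
    {ae lebesgue01 R, forall x : R,
      bfs_class (a *: u + v) x = a * bfs_class u x + bfs_class v x};
  bfs_ideal : forall (u : bfs_space) (g : mclass R),
    {ae lebesgue01 R, forall x : R, `|g x| <= `|bfs_class u x| } ->
    exists2 v : bfs_space, bfs_class v = g & `|v| <= `|u| }.

(* f^*, with values in [0, +oo] (f^*(0) may be infinite). *)
Definition rearrangement (R : realType) (f : R -> R) (t : R) : \bar R :=
  ereal_inf [set tau%:E | tau in [set tau : R |
    0 <= tau /\ (lebesgue01 R [set x | (tau < `|f x|)%R] <= t%:E)%E]].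

(* The zero space is excluded: a r.i. space is meant to satisfy
   L^oo `<=` X `<=` L^1, which follows from the two clauses below. *)
Definition rearrangement_invariant (R : realType) (X : bfs R) : Prop :=
  (exists u : X, u != 0) /\
  (forall (u : X) (g : mclass R),
    (forall t : R, 0 <= t <= 1 ->
      (rearrangement g t <= rearrangement (bfs_class u) t)%E) ->
    exists2 v : X, bfs_class v = g & `|v| <= `|u|).

Definition Linfty (R : realType) : set (mclass R) :=
  [set f | finite_norm (lebesgue01 R) +oo%E f].
Arguments Linfty R : clear implicits.

(* The elements of X whose class is that of h (at most one element). *)
Definition bfs_elem (R : realType) (X : bfs R) (h : R -> \bar R) : set X :=
  [set u | {ae lebesgue01 R, forall x : R, (bfs_class u x)%:E = h x}].
Arguments bfs_elem {R} X h.

(* Extended-real valued, so that [cesaro_space] below really requires the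
   integrals of |f| to be finite. *)
Definition cesaro_mean (R : realType) (f : R -> R) (x : R) : \bar R :=
  ((x^-1)%:E * \int[lebesgue01 R]_(t in `[0%R, x]) (f t)%:E)%E.

Definition cesaro_space (R : realType) (X : bfs R) : set (mclass R) :=
  [set f | bfs_elem X (cesaro_mean (fun t => `|f t|)) !=set0].

Definition cesaro_norm (R : realType) (X : bfs R) (f : mclass R) : R :=
  `|xget 0 (bfs_elem X (cesaro_mean (fun t => `|f t|)))|.

(* The Cesaro operator from [cesaro_space X] to X; the default value 0 is only
   taken outside [cesaro_space X], see [cesaro_opP]. *)
Definition cesaro_op (R : realType) (X : bfs R) (f : mclass R) : X :=
  xget 0 (bfs_elem X (cesaro_mean f)).

Lemma cesaro_opP (R : realType) (X : bfs R) (f : mclass R) :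
  cesaro_space X f -> bfs_elem X (cesaro_mean f) (cesaro_op X f).
Proof.
case=> u uf; suff [v vf] : bfs_elem X (cesaro_mean f) !=set0 by exact: (xgetI _ vf).
pose mu := lebesgue01 R.
pose f' : R -> R := f.
have mf' : measurable_fun [set: R] f' by exact: (@measurable_funPT _ _ _ _ (repr f)).
have mf : measurable_fun [set: R] (EFin \o f') by exact/measurable_EFinP.
pose I (h : R -> \bar R) (x : R) := (\int[mu]_(t in `[0%R, x]) h t)%E.
have I_ge0 h x : (forall t, 0 <= h t)%E -> (0 <= I h x)%E.
  by move=> h0; exact: integral_ge0.
have I_nd h : measurable_fun [set: R] h ->
    (forall t, 0 <= h t)%E -> {homo I h : x y / x <= y >-> (x <= y)%E}.
  move=> mh h0 x y xy; apply: ge0_subset_integral => //.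
    exact: measurable_funTS.
  by apply: subset_itvl; rewrite bnd_simp.
have mI h : measurable_fun [set: R] h ->
    (forall t, 0 <= h t)%E -> measurable_fun [set: R] (I h).
  move=> mh h0; apply: (measurability _ (ErealGenOInfty.measurableE R)).
  move=> _ [_ [r ->] <-]; rewrite setTI; apply: is_interval_measurable => s t /=.
  rewrite !in_itv/= !andbT => fs _ w /andP[sw _].
  by rewrite in_itv/= andbT (lt_le_trans fs)// I_nd.
have mAf : measurable_fun [set: R] (abse \o (EFin \o f')).
  exact: measurableT_comp.
have If_fin x : 0 < x -> x < 1 -> (I (abse \o (EFin \o f')) x < +oo)%E.
  move=> x0 x1; rewrite ltNge leye_eq; apply/negP => /eqP Ioo.
  case: uf => N [mN N0 sN].
  have : (mu `]x, 1%R[%classic <= mu N)%E.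
    apply: le_measure; rewrite ?inE//= => y /=; rewrite in_itv/= => /andP[xy y1].
    apply: sN => /= uy; have := uy; rewrite /cesaro_mean.
    rewrite (_ : integral _ _ _ = +oo%E).
      by rewrite gt0_muley// lte_fin invr_gt0 (lt_trans x0).
    by apply/eqP; rewrite -leye_eq -Ioo; exact: (I_nd _ mAf (fun t => abse_ge0 _) _ _ (ltW xy)).
  rewrite N0 /mu /lebesgue01/= /mrestr setIidl; last first.
    move=> y /=; rewrite !in_itv/= => /andP[xy y1].
    by rewrite (ltW (lt_trans x0 xy)) ltW.
  by rewrite lebesgue_measure_itv/= lte_fin x1 -EFinD lee_fin subr_le0 leNgt x1.
have FF : Filter (nbhs (almost_everywhere mu)).
  exact: (ae_filter_ringOfSetsType mu).
pose D : set R := `]0%R, 1%R[%classic.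
pose g0 (x : R) := x^-1 * (fine (I ((EFin \o f')^\+)%E x) - fine (I ((EFin \o f')^\-)%E x)).
have mg0 : measurable_fun [set: R] (g0 \_ D).
  have mD : measurable D by exact: measurable_itv.
  apply: (iffLR (measurable_restrictT g0 mD)).
  rewrite /g0; apply: (@measurable_funM _ _ R D (fun x : R => x^-1) (fun x => fine _ - fine _)%R).
    apply: open_continuous_measurable_fun; first exact: interval_open.
    move=> x; rewrite inE /D/= in_itv/= => /andP[x0 _].
    by apply: inv_continuous; rewrite gt_eqF.
  apply: measurable_funTS; apply: (@measurable_funB _ _ R setT (fun x => fine _) (fun x => fine _)).
    by apply: measurableT_comp => //; apply: mI => //; exact: measurable_funepos.
  by apply: measurableT_comp => //; apply: mI => //; exact: measurable_funeneg.
pose g : {mfun measurableTypeR R >-> measurableTypeR R} :=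
  @mfun_Sub _ _ (measurableTypeR R) (measurableTypeR R) (g0 \_ D) (mem_set mg0).
have aeD : {ae mu, forall x, D x}.
  exists (~` D); split.
  - by apply: measurableC; exact: measurable_itv.
  - rewrite /mu /lebesgue01/= /mrestr; apply: countable_lebesgue_measure0.
    apply: (sub_countable (B := [set 0; 1])); last exact/finite_set_countable.
    apply: subset_card_le => x [] /=; rewrite /D/= !in_itv/= => xD /andP[x0 x1].
    move/negP: xD; rewrite negb_and -!leNgt => /orP[x0'|x1'].
      by left; apply/eqP; rewrite eq_le x0 x0'.
    by right; apply/eqP; rewrite eq_le x1 x1'.
  - by [].
have gE x : D x -> (g x)%:E = cesaro_mean f x.
  move=> Dx; have := Dx; rewrite /D/= in_itv/= => /andP[x0 x1].
  have fin h : (forall t, 0 <= h t)%E -> (forall t, h t <= `|(f' t)%:E|)%E ->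
      measurable_fun [set: R] h -> I h x \is a fin_num.
    move=> h0 hf mh; rewrite ge0_fin_numE ?I_ge0//.
    apply: le_lt_trans (If_fin x x0 x1).
    apply: ge0_le_integral => //; first exact: measurable_funTS.
    exact: measurable_funTS.
  rewrite /g /= patchT ?inE// /g0 /cesaro_mean integralE EFinM EFinB.
  have le_pos t : ((EFin \o f')^\+ t <= `|(f' t)%:E|)%E.
    by rewrite funeposE ge_max lee_abs abse_ge0.
  have le_neg t : ((EFin \o f')^\- t <= `|(f' t)%:E|)%E.
    by rewrite funenegE ge_max -abseN lee_abs abse_ge0.
  by rewrite !fineK//; apply: fin => //;
    [exact: measurable_funeneg|exact: measurable_funepos].
pose gc : mclass R := \pi_(mclass R)%qT g.
have gcE : {ae mu, forall x, gc x = g x}.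
  have /eqquotP/asboolP : (repr gc = g %[mod mclass R])%qT by rewrite reprK.
  by apply: filterS => x; exact.
have [] := @bfs_ideal R X u gc.
  move: aeD gcE uf; apply: filterS3 => x Dx -> ux.
  rewrite -lee_fin -!abse_EFin gE// ux /cesaro_mean !abseM.
  apply: lee_wpmul2l => //; apply: le_trans (le_abse_integral _ _ _) _ => //.
    exact: measurable_funTS.
  exact: lee_abs.
move=> v vE _; exists v.
rewrite /bfs_elem/= vE; apply: filterS2 aeD gcE => x Dx ->; exact: gE.
Qed.

Definition cesaro_op_compact (R : realType) (X : bfs R) : Prop :=
  precompact (cesaro_op X @`
    [set f | cesaro_space X f /\ cesaro_norm X f <= 1]).

(* Main.v *)
(* For a < 1 close to 1, a multiple of the indicator of [a, 1] has norm 1 in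
   [C, X], and so has its image under C in X, which vanishes on [0, a). As a
   tends to 1, a cluster point of these images would vanish a.e. on every [0, r)
   with r < 1, hence be 0, although it is a limit of elements of norm 1. The
   images do lie in X, as X contains a nonzero function and hence, by
   rearrangement invariance, all bounded functions of small enough support. *)
Require Import Defs.
From mathcomp Require Import all_boot all_order all_algebra.
From mathcomp Require Import all_classical all_reals all_analysis.
From mathcomp Require Import measurable_realfun ring lra.

Set Implicit Arguments.
Unset Strict Implicit.
Unset Printing Implicit Defensive.

Import Order.TTheory GRing.Theory Num.Theory.
Import numFieldNormedType.Exports.

Local Open Scope classical_set_scope.
Local Open Scope ring_scope.

(** * Classes modulo null sets on [0, 1] *)

Section classes.
Context {R : realType}.
Implicit Types f g : mclass R.
Let mu := lebesgue01 R.

Lemma mclass_measurable f : measurable_fun [set: R] (f : R -> R).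
Proof. exact: (@measurable_funPT _ _ _ _ (repr f)). Qed.

Lemma mclassP (h : R -> R) : measurable_fun [set: R] h ->
  exists f : mclass R, {ae mu, forall x, f x = h x}.
Proof.
move=> mh.
pose g : {mfun measurableTypeR R >-> measurableTypeR R} :=
  @mfun_Sub _ _ (measurableTypeR R) (measurableTypeR R) h (mem_set mh).
exists (\pi_(mclass R)%qT g).
have /eqquotP/asboolP :
  (repr (\pi_(mclass R)%qT g) = g %[mod mclass R])%qT by rewrite reprK.
have FF := ae_filter_ringOfSetsType mu.
by apply: filterS => x; exact.
Qed.

Lemma mclass_eq f g : {ae mu, forall x, f x = g x} -> f = g.
Proof.
move=> fg; rewrite -[f]reprK -[g]reprK; apply/eqquotP/asboolP.
have FF := ae_filter_ringOfSetsType mu.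
by move: fg; apply: filterS => x fgx _.
Qed.

Lemma lebesgue01E (A : set R) : mu A = lebesgue_measure (A `&` `[0, 1]%classic).
Proof. by []. Qed.

Lemma ae_in01 : {ae mu, forall x, 0 < x < 1}.
Proof.
exists (~` `]0, 1[%classic); split.
- by apply: measurableC; exact: measurable_itv.
- rewrite lebesgue01E; apply: countable_lebesgue_measure0.
  apply: (sub_countable (B := [set 0; 1])); last exact/finite_set_countable.
  apply: subset_card_le => x [] /=; rewrite !in_itv/= => xD /andP[x0 x1].
  move/negP: xD; rewrite negb_and -!leNgt => /orP[x0'|x1'].
    by left; apply/eqP; rewrite eq_le x0 x0'.
  by right; apply/eqP; rewrite eq_le x1 x1'.
- by move=> x; apply: contra_not; rewrite /= in_itv.
Qed.

(** [A] lies in the union of [B] and a null set. This turns a.e. bounds on a class into bounds on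
    the measures of its level sets. *)
Lemma ae_le_measure (A B : set R) : measurable A -> measurable B ->
  {ae mu, forall x, A x -> B x} -> (mu A <= mu B)%E.
Proof.
move=> mA mB [N [mN N0 AB]].
have mBN : measurable (B `|` N) by exact: measurableU.
apply: (@le_trans _ _ (mu (B `|` N))).
  apply: le_measure; rewrite ?inE// => x Ax.
  by have [|nBx] := pselect (B x); [left|right; apply: AB => /(_ Ax)].
by rewrite -[leRHS]adde0 -N0; exact: measureU2.
Qed.

Lemma measurable_superlevel (h : R -> R) (c : R) : measurable_fun [set: R] h ->
  measurable [set x | c < `|h x|].
Proof.
move=> mh; rewrite -[X in measurable X]setTI.
have mnh : measurable_fun [set: R] (fun x => `|h x|) by exact: measurableT_comp.
have := mnh measurableT `]c, +oo[%classic (measurable_itv _).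
by congr (measurable (_ `&` _));
  apply/seteqP; split => x /=; rewrite in_itv/= andbT.
Qed.

End classes.

(** * Vanishing, cluster points and membership in function spaces *)

Section banach_function_space.
Context {R : realType} (X : bfs R).
Let mu := lebesgue01 R.
Let FF := ae_filter_ringOfSetsType mu.
Local Existing Instance FF.

Lemma bfs_class_ae_inj (u v : X) :
  {ae mu, forall x, bfs_class u x = bfs_class v x} -> u = v.
Proof. by move=> uv; apply: bfs_class_inj; exact: mclass_eq. Qed.

Lemma bfs_class0 : {ae mu, forall x, bfs_class (0 : X) x = 0}.
Proof.
(* Linearity at 1 * 0 + 0 says that the value c of the class of 0 satisfies c = c + c. *)
have := bfs_class_linear 1 (0 : X) 0; rewrite scaler0 addr0.
by apply: filterS => x; rewrite mul1r => /eqP; rewrite -subr_eq subrr => /eqP.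
Qed.

Lemma bfs_classZ (a : R) (u : X) :
  {ae mu, forall x, bfs_class (a *: u) x = a * bfs_class u x}.
Proof.
have := bfs_class_linear a u 0; rewrite addr0.
by apply: filterS2 bfs_class0 => x -> ->; rewrite addr0.
Qed.

Lemma bfs_classB (u v : X) :
  {ae mu, forall x, bfs_class (u - v) x = bfs_class u x - bfs_class v x}.
Proof.
have := bfs_class_linear (-1) v u; rewrite scaleN1r addrC.
by apply: filterS => x ->; rewrite mulN1r addrC.
Qed.

(** Uniqueness evaluates the choice [xget] in [cesaro_op] and [cesaro_norm] as soon as one member is
    known. *)
Lemma bfs_elem_subset1 (h : R -> \bar R) : is_subset1 (bfs_elem X h).
Proof.
move=> u v uh vh; apply: bfs_class_ae_inj.
by apply: filterS2 uh vh => x <- [].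
Qed.

(* The classes vanishing a.e. on A form a closed subspace, because
   1_A * p is dominated by p - e for every e in it. *)
Lemma bfs_vanish_closed (A : set R) (p : X) : measurable A ->
  (forall eps, 0 < eps -> exists2 e : X,
    {ae mu, forall x, A x -> bfs_class e x = 0} & `|p - e| < eps) ->
  {ae mu, forall x, A x -> bfs_class p x = 0}.
Proof.
move=> mA pA.
have [g gE] : exists g : mclass R,
    {ae mu, forall x, g x = bfs_class p x * \1_A x}.
  apply: mclassP; apply: measurable_funM; first exact: mclass_measurable.
  exact: measurable_indic.
have near_e (eps : R) : 0 < eps -> exists2 v : X, bfs_class v = g & `|v| < eps.
  move=> /pA[e e0 pe].
  have [|v vg vpe] := @bfs_ideal _ X (p - e) g.
    move: e0 gE (bfs_classB p e); apply: filterS3 => x e0 -> ->.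
    have [xA|xA] := pselect (A x).
      by rewrite (e0 xA) subr0 indicE mem_set// mulr1.
    by rewrite indicE memNset// mulr0 normr0.
  by exists v => //; exact: le_lt_trans pe.
have [v vg _] := near_e 1 ltr01.
(* By injectivity of [bfs_class], the elements of norm below eps found for the various eps are all
   equal to [v]. *)
have v0 : v = 0.
  apply/eqP; rewrite -normr_eq0; apply/eqP/le_anti/andP; split => //.
  apply/ler_addgt0Pl => eps /near_e[w wg /ltW]; rewrite addr0.
  by rewrite (bfs_class_inj (etrans wg (esym vg))).
move: gE; rewrite -vg v0; apply: filterS2 bfs_class0 => x -> + xA.
by rewrite indicE mem_set// mulr1.
Qed.

(** For r < 1, [p] is a limit of terms [e n] with r < [a n], which vanish to the left of r;
    closedness passes this on to [p]. Hence [p] is 0, yet some [e n] of norm 1 is at distance less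
    than 1 from it. *)
Lemma no_cluster_escaping (a : nat -> R) (e : nat -> X) (p : X) :
  a @ \oo --> (1 : R) ->
  (forall n, {ae mu, forall x, x < a n -> bfs_class (e n) x = 0}) ->
  (forall n, `|e n| = 1) -> ~ cluster (e @ \oo) p.
Proof.
move=> a1 ea e1 clp.
(* Each tail of the sequence belongs to the filter, so it meets every ball around [p]. *)
have often (eps : R) N : 0 < eps -> exists2 n, (N <= n)%N & `|p - e n| < eps.
  move=> eps0.
  have [||_ [[n Nn <-] pn]] := clp (e @` [set n | (N <= n)%N]) (ball p eps).
  - by exists N => // n Nn; exists n.
  - exact: nbhsx_ballx.
  - by exists n => //; move: pn; rewrite -ball_normE.
have p0 (r : R) : r < 1 -> {ae mu, forall x, x < r -> bfs_class p x = 0}.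
  move=> r1; apply: (@bfs_vanish_closed [set x | x < r] p).
    by rewrite -set_itvE; exact: measurable_itv.
  move=> eps eps0; have [N _ aN] := cvgr_gt _ a1 _ r1.
  have [n Nn pe] := often eps N eps0.
  exists (e n) => //; apply: filterS (ea n) => x ex /= xr.
  by apply: ex; exact: lt_trans xr (aN n Nn).
have p_eq0 : p = 0.
  apply: bfs_class_ae_inj.
  (* Countably many r suffice to exhaust x < 1, so the exceptional null sets merge into one. *)
  have : {ae mu, forall x, forall n, x < 1 - n.+1%:R^-1 -> bfs_class p x = 0}.
    by apply: ae_foralln => n; apply: p0; rewrite ltrBlDr ltrDl invr_gt0.
  move: (@ae_in01 R) bfs_class0; apply: filterS3 => x /andP[_ x1] -> px.
  have x1' : 0 < 1 - x by rewrite subr_gt0.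
  have [N _ /(_ N (leqnn N)) /= xN] := near_infty_natSinv_lt (PosNum x1').
  by apply: (px N); rewrite ltrBrDr -ltrBrDl.
have [n _] := often 1 0%N ltr01.
by rewrite p_eq0 sub0r normrN e1 ltxx.
Qed.

(** If all the level sets for c = 1/(n+1) were null, so would be their union, which is the set where
    [u] is nonzero. *)
Lemma bfs_nonzero_level (u : X) : u != 0 ->
  exists2 c : R, 0 < c & mu [set x | c < `|bfs_class u x|] != 0%E.
Proof.
move=> u0; apply: contrapT => noc; move/negP: u0; apply; apply/eqP.
apply: bfs_class_ae_inj.
have : {ae mu, forall x, forall n, `|bfs_class u x| <= n.+1%:R^-1}.
  apply: ae_foralln => n; exists [set x | n.+1%:R^-1 < `|bfs_class u x|].
  split; last by move=> x /= /negP; rewrite -ltNge.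
    by apply: measurable_superlevel; exact: mclass_measurable.
  apply/eqP; apply: contrapT => /negP lev; apply: noc.
  by exists n.+1%:R^-1 => //; rewrite invr_gt0.
apply: filterS2 bfs_class0 => x -> ux.
apply/eqP; rewrite -normr_eq0; apply/eqP/le_anti/andP; split => //.
apply/ler_addgt0Pl => eps eps0; rewrite addr0.
have [N _ /(_ N (leqnn N)) /= xN] := near_infty_natSinv_lt (PosNum eps0).
exact: le_trans (ux N) (ltW xN).
Qed.

(** Take for s the measure of a level set {c < |u|} of some nonzero u in X. Then (c h)^* is at most
    c on [0, s) and 0 from s on, whereas u^* is at least c on [0, s). Rearrangement invariance puts
    c h in X, and scaling gives h. *)
Lemma ri_bounded_mem : rearrangement_invariant X -> exists2 s : R, 0 < s &
  forall h : R -> R, measurable_fun [set: R] h -> (forall x, `|h x| <= 1) ->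
  (mu [set x | h x != 0%R] <= s%:E)%E ->
  exists u : X, {ae mu, forall x, bfs_class u x = h x}.
Proof.
move=> [[u u0] ri].
have [c c0 muc] := bfs_nonzero_level u0.
have mu_lev := measurable_superlevel c (@mclass_measurable _ (bfs_class u)).
set m := mu _ in muc.
have mfin : m \is a fin_num.
  rewrite ge0_fin_numE ?measure_ge0//.
  apply: (@le_lt_trans _ _ (lebesgue_measure (`[0, 1]%classic : set R))).
    apply: le_measure; rewrite ?inE; [|exact: measurable_itv|exact: subIsetr].
    by apply: measurableI => //; exact: measurable_itv.
  by rewrite lebesgue_measure_itv/= lte_fin ltr01 -EFinD ltry.
exists (fine m).
  by rewrite fine_gt0// lt0e muc measure_ge0 -ge0_fin_numE ?measure_ge0.
move=> h mh h1; rewrite fineK// => hm.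
have [g gE] : exists g : mclass R, {ae mu, forall x, g x = c * h x}.
  by apply: mclassP; exact: measurable_funM.
have mg tau := measurable_superlevel tau (@mclass_measurable _ g).
have [t t01|v vg _] := ri u g.
  (* For t < m, [c] lies between the two rearrangements: |g| <= c a.e., and a tau < c is not
     admissible for u^*(t), since its level set has measure at least m > t. *)
  have [tm|mt] := ltP t%:E m.
    apply: (@le_trans _ _ c%:E).
      apply: ereal_inf_lbound; exists c => //; split; first exact: ltW.
      apply: (@le_trans _ _ 0%E); last by rewrite lee_fin; case/andP: t01.
      rewrite -(measure0 mu); apply: ae_le_measure => //.
      apply: filterS gE => x gx /=.
      by rewrite gx normrM gtr0_norm// ltNge ler_piMr// ltW.
    apply/ereal_infP => _ [tau [tau0 taut] <-]; rewrite lee_fin leNgt.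
    apply/negP => tauc; move: tm; rewrite ltNge => /negP; apply.
    apply: le_trans taut; apply: le_measure; rewrite ?inE//.
      by apply: measurable_superlevel; exact: mclass_measurable.
    by move=> x /=; exact: lt_trans.
  (* For t >= m, tau = 0 is admissible for [g], whose support has measure at most m. *)
  apply: (@le_trans _ _ 0%E).
    apply: ereal_inf_lbound; exists 0 => //; split => //.
    apply: le_trans mt; apply: le_trans hm.
    have -> : [set x | h x != 0] = [set x | 0 < `|h x|].
      by apply/seteqP; split => x /=; rewrite normr_gt0.
    apply: ae_le_measure => //; first exact: measurable_superlevel.
    by apply: filterS gE => x gx /=; rewrite gx !normr_gt0 mulf_eq0 negb_or => /andP[].
  by apply/ereal_infP => _ [tau [tau0 _] <-]; rewrite lee_fin.
exists (c^-1 *: v); move: gE (bfs_classZ c^-1 v); rewrite vg.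
by apply: filterS2 => x -> ->; rewrite mulKf// gt_eqF.
Qed.

End banach_function_space.

(** * Cesàro means of multiples of the indicator of [a, 1] *)

(* The Cesaro mean of the indicator of [a, 1], for 0 < x <= 1: the maximum keeps
   it continuous on the line, with value 0 to the left of a. *)
Definition ramp {R : realType} (a x : R) : R := 1 - a / Num.max x a.

Section ramp.
Context {R : realType}.
Variables (a : R) (a0 : 0 < a).
Let mu := lebesgue01 R.

Lemma measurable_ramp : measurable_fun [set: R] (ramp a).
Proof.
apply: measurable_funB => //.
apply: measurable_funM => //.
have max0 x : Num.max x a != 0 by rewrite gt_eqF// lt_max a0 orbT.
apply: continuous_measurable_fun => x; apply: cvgV => //.
apply: (@max_fun_continuous _ _ R id (cst a)); first by move=> y; exact: cvg_id.
by move=> y; exact: cvg_cst.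
Qed.

Lemma ramp_eq0 x : x <= a -> ramp a x = 0.
Proof. by move=> xa; rewrite /ramp max_r// divff ?subrr// gt_eqF. Qed.

Lemma rampE x : a <= x -> ramp a x = 1 - a / x.
Proof. by move=> ax; rewrite /ramp max_l. Qed.

Lemma ramp_ge0 x : 0 <= ramp a x.
Proof.
by rewrite subr_ge0 ler_pdivrMr ?mul1r ?le_max ?lt_max ?a0 ?lexx orbT.
Qed.

Lemma ramp_le1 x : ramp a x <= 1.
Proof. by rewrite gerBl divr_ge0 ?(ltW a0)// le_max (ltW a0) orbT. Qed.

(** For a < x < 1 the integral over [0, x] is b (x - a), and (x - a) / x = 1 - a / x; for x <= a it
    is 0. *)
Lemma cesaro_mean_indic (b : R) (h : R -> R) : 0 <= b ->
  measurable_fun [set: R] h ->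
  {ae mu, forall x, h x = b * \1_`[a, 1] x} ->
  {ae mu, forall x, cesaro_mean h x = (b * ramp a x)%:E}.
Proof.
move=> b0 mh hE.
have FF := ae_filter_ringOfSetsType mu.
apply: filterS (@ae_in01 R) => x /andP[x0 x1].
rewrite /cesaro_mean.
have mA : measurable (`[a, 1]%classic : set R) by exact: measurable_itv.
have mIx : measurable (`[0, x]%classic : set R) by exact: measurable_itv.
have m1 : measurable_fun (`[0, x]%classic : set R)
    (fun t => (\1_`[a, 1] t)%:E : \bar R).
  by apply/measurable_EFinP; exact: measurable_indic.
have -> : (\int[mu]_(t in `[0%R, x]) (h t)%:E =
    \int[mu]_(t in `[0%R, x]) (b%:E * (\1_`[a, 1] t)%:E))%E.
  apply: ae_eq_integral => //.
  - by apply/measurable_EFinP; exact: measurable_funTS.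
  - exact: measurable_funeM.
  - by apply: filterS hE => t -> _; rewrite EFinM.
rewrite ge0_integralZl// integral_indic// lebesgue01E.
have -> : `[a, 1]%classic `&` `[0, x]%classic `&` `[0, 1]%classic = `[a, x]%classic.
  apply/seteqP; split => y /=; rewrite !in_itv/=; first by lra.
  move=> /andP[ay yx]; have y0 := le_trans (ltW a0) ay.
  by have y1 := le_trans yx (ltW x1); rewrite ay yx y0 y1.
rewrite lebesgue_measure_itv/= lte_fin; case: ltP => ax.
  by rewrite -EFinD -!EFinM rampE ?ltW//; congr EFin; field; rewrite gt_eqF.
by rewrite !mule0 ramp_eq0// mulr0.
Qed.

End ramp.

(** Take f = b 1_[a, 1] with b the inverse of the norm of [w]. As f is nonnegative, the means of f
    and of |f| are the same element b w of X, so f has norm 1 in [C, X] and its image has norm 1 in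
    X. *)
Lemma cesaro_unit_image (R : realType) (X : bfs R) (a : R) (w : X) :
  0 < a < 1 -> {ae lebesgue01 R, forall x, bfs_class w x = ramp a x} ->
  exists f : mclass R, [/\ cesaro_space X f /\ cesaro_norm X f <= 1,
    `|cesaro_op X f| = 1 &
    {ae lebesgue01 R, forall x, x < a -> bfs_class (cesaro_op X f) x = 0}].
Proof.
move=> /andP[a0 a1] wE.
have FF := ae_filter_ringOfSetsType (lebesgue01 R).
have w0 : w != 0.
  (* If [w] were 0, then 1 - a / x = 0, that is x = a, for almost every x in ]a, 1[, an interval of
     positive measure 1 - a. *)
  apply/eqP => w0; have [N [mN N0 sN]] : {ae lebesgue01 R, forall x, ~ (a < x < 1)}.
    move: wE (bfs_class0 X); rewrite w0; apply: filterS2 => x -> + /andP[ax x1].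
    rewrite rampE ?ltW// => /eqP; rewrite subr_eq0 => /eqP /esym/divr1_eq axe.
    by move: ax; rewrite axe ltxx.
  have : (lebesgue01 R `]a, 1%R[%classic <= lebesgue01 R N)%E.
    apply: le_measure; rewrite ?inE//= => x /=; rewrite in_itv/= => ax.
    by apply: sN => /=; apply.
  rewrite N0 lebesgue01E setIidl => [|x /=]; last by rewrite !in_itv/=; lra.
  by rewrite lebesgue_measure_itv/= lte_fin a1 -EFinD lee_fin subr_le0 leNgt a1.
pose b := `|w|^-1.
have b0 : 0 <= b by rewrite invr_ge0.
have [f fE] : exists f : mclass R,
    {ae lebesgue01 R, forall x, f x = b * \1_`[a, 1] x}.
  apply: mclassP; apply: measurable_funM => //; exact: measurable_indic.
(* Stated for functions, so as to serve for both f and |f|. *)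
have elem (h : R -> R) : measurable_fun [set: R] h ->
    {ae lebesgue01 R, forall x, h x = b * \1_`[a, 1] x} ->
    bfs_elem X (cesaro_mean h) (b *: w).
  move=> mh hE; have := cesaro_mean_indic a0 b0 mh hE.
  by move: wE (bfs_classZ b w); apply: filterS3 => x wx bx ->; rewrite bx wx.
have fw := elem f (mclass_measurable f) fE.
have afw : bfs_elem X (cesaro_mean (fun t => `|f t|)) (b *: w).
  apply: elem; first by apply: measurableT_comp => //; exact: mclass_measurable.
  apply: filterS fE => x ->; rewrite ger0_norm// mulr_ge0//.
have bw1 : `|b *: w| = 1.
  by rewrite normrZ ger0_norm// mulVf// normr_eq0.
have opf : cesaro_op X f = b *: w.
  by apply: xget_subset1 => //; exact: bfs_elem_subset1.
exists f; rewrite opf; split => //.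
  split; first by exists (b *: w).
  rewrite /cesaro_norm (xget_subset1 _ afw) ?bw1//; exact: bfs_elem_subset1.
move: wE (bfs_classZ b w); apply: filterS2 => x -> -> /ltW xa.
by rewrite ramp_eq0// mulr0.
Qed.

(** * A sequence of images without cluster point *)

Theorem proposition4p2 (R : realType) (X : bfs R)
    (riX : rearrangement_invariant X)
    (X_neq_Linfty : range (@bfs_class R X) <> Linfty R) :
  ~ cesaro_op_compact X.
Proof.
have [s s0 Xbnd] := ri_bounded_mem riX.
(* The bound r <= s makes [[a n], 1] small enough for [Xbnd], and r <= 1/2 keeps [a n] positive. *)
pose r := Num.min s 2^-1.
have r0 : 0 < r by rewrite lt_min s0 invr_gt0 ltr0n.
have rs : r <= s by rewrite ge_min lexx.
have r1 : r < 1 by rewrite gt_min invf_lt1 ?ltr1n ?orbT.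
pose a n : R := 1 - r * n.+1%:R^-1.
have a01 n : 0 < a n < 1.
  have n1 : n.+1%:R^-1 <= 1 :> R by rewrite invf_le1// ler1n.
  rewrite subr_gt0 gtrBl mulr_gt0 ?invr_gt0// andbT.
  by apply: le_lt_trans r1; rewrite ler_piMr// ltW.
have ar n : 1 - a n <= s.
  apply: le_trans rs; rewrite subKr ler_piMr ?(ltW r0)//.
  by rewrite invf_le1// ler1n.
have /choice[f fP] n : exists f : mclass R,
    [/\ cesaro_space X f /\ cesaro_norm X f <= 1, `|cesaro_op X f| = 1 &
     {ae lebesgue01 R, forall x, x < a n -> bfs_class (cesaro_op X f) x = 0}].
  have /andP[an0 an1] := a01 n.
  have [||w wE] := Xbnd (ramp (a n)) (measurable_ramp an0).
  - by move=> x; rewrite ger0_norm ?ramp_le1// ramp_ge0.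
  (* Within [0, 1] the ramp is supported in [[a n], 1], of measure 1 - [a n] <= s. *)
  - apply: (@le_trans _ _ (lebesgue_measure (`[a n, 1]%classic : set R))).
      rewrite lebesgue01E; apply: le_measure; rewrite ?inE.
      + apply: measurableI; last exact: measurable_itv.
        rewrite (_ : [set x | _] = [set x | 0 < `|ramp (a n) x|]).
          exact: measurable_superlevel (measurable_ramp an0).
        by apply/seteqP; split => x /=; rewrite normr_gt0.
      + exact: measurable_itv.
      + move=> x [/= rx]; rewrite !in_itv/= => /andP[_ ->]; rewrite andbT.
        by rewrite leNgt; apply: contra rx => /ltW xa; rewrite ramp_eq0.
    by rewrite lebesgue_measure_itv/= lte_fin an1 -EFinD lee_fin.
  - exact: cesaro_unit_image (a01 n) wE.
(* Compactness of the closure of the image of the unit ball, applied to the filter of tails of the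
   sequence, yields a cluster point [p]. *)
rewrite /cesaro_op_compact precompactE => /(_ ((cesaro_op X \o f) @ \oo)).
case=> [|p [_ clp]].
  exists 0%N => // n _; apply: subset_closure.
  by exists (f n) => //; have [] := fP n.
apply: (@no_cluster_escaping _ X a (cesaro_op X \o f) p) clp.
- rewrite -[X in _ --> X]subr0 -[X in _ --> _ - X](mulr0 r).
  by apply: cvgB; [exact: cvg_cst|apply: cvgM; [exact: cvg_cst|exact: cvg_harmonic]].
- by move=> n; have [] := fP n.
- by move=> n; have [] := fP n.
Qed.
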